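(* Let $p$ be a (pretrained) autoregressive language model over a finite vocabulary $\mathcal{V}$ with sequences $\bm{x}_{0:T}=(x_0,\dots,x_T)\in\mathcal{V}^{T+1}$, let $\bm{q}$ be an input prompt and let $\alpha>1$. Then for every $t\in\{0,\dots,T\}$, every partially generated sequence $\bm{x}_{0:t-1}=(x_0,\dots,x_{t-1})$ with $p(\bm{q},\bm{x}_{0:t-1})>0$, and every token $x_t\in\mathcal{V}$, $$p^{(\mathrm{pow})}_{\alpha}(x_t\mid\bm{q},\bm{x}_{0:t-1})=\frac{p^{\alpha}(x_t\mid\bm{q},\bm{x}_{0:t-1})\,\zeta_t(x_t)}{\sum_{x'_t\in\mathcal{V}}p^{\alpha}(x'_t\mid\bm{q},\bm{x}_{0:t-1})\,\zeta_t(x'_t)},$$ where for each token $x'_t\in\mathcal{V}$ $$\zeta_t(x'_t)=\sum_{\bm{x}_{t+1:T}}p^{\alpha}(\bm{x}_{t+1:T}\mid\bm{q},\bm{x}_{0:t-1},x'_t).$$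
   Context: $\mathcal{V}$ is a finite vocabulary and $T$ a fixed horizon. An autoregressive language model $p$ assigns to the prompt $\bm{q}$ and to every prefix $\bm{x}_{0:s-1}\in\mathcal{V}^{s}$, $0\le s\le T$ (empty when $s=0$), a probability distribution $p(\cdot\mid\bm{q},\bm{x}_{0:s-1})$ on $\mathcal{V}$. The joint and conditional probabilities of blocks are given by the chain rule: $p(\bm{x}_{t+1:T}\mid\bm{q},\bm{x}_{0:t})=\prod_{s=t+1}^{T}p(x_s\mid\bm{q},\bm{x}_{0:s-1})$ and $p(\bm{q},\bm{x}_{0:t})=p(\bm{q})\prod_{s=0}^{t}p(x_s\mid\bm{q},\bm{x}_{0:s-1})$, with $p(\bm{q})>0$. Notation: $p^{\alpha}(\cdot)=(p(\cdot))^{\alpha}$; $\bm{x}_{t+1:T}=(x_{t+1},\dots,x_T)$; sums over $\bm{x}_{t+1:T}$ range over $\mathcal{V}^{T-t}$ (for $t=T$ there is only the empty continuation, with conditional probability $1$). The power distribution of the next token is $$p^{(\mathrm{pow})}_{\alpha}(x_t\mid\bm{q},\bm{x}_{0:t-1})=\frac{\sum_{\bm{x}_{t+1:T}}p^{\alpha}(\bm{q},\bm{x}_{0:t-1},x_t,\bm{x}_{t+1:T})}{\sum_{\bm{x}_{t:T}}p^{\alpha}(\bm{q},\bm{x}_{0:t-1},\bm{x}_{t:T})},$$ where the sum in the denominator is over $\bm{x}_{t:T}\in\mathcal{V}^{T-t+1}$. *)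

(* Defs.v *)
From HB Require Import structures.
From mathcomp Require Import all_boot all_order all_algebra.
From mathcomp Require Import reals exp.
Set Implicit Arguments.
Unset Strict Implicit.
Unset Printing Implicit Defensive.
Import Order.TTheory GRing.Theory Num.Theory.
Local Open Scope ring_scope.

(* [Q] is the type of prompts; any type will do, e.g. [seq V].  The prefix
   x_{0:s-1} is a sequence of size s.  Only prefixes of size at most T are
   constrained; the values of [next_prob] on longer ones are irrelevant. *)
Record ar_model (R : realType) (Q : Type) (V : finType) (T : nat) := ARModel {
  prompt_prob : Q -> R;
  next_prob : Q -> seq V -> V -> R;
  next_prob_ge0 : forall (q : Q) (x : seq V) (v : V),
    (size x <= T)%N -> 0 <= next_prob q x v;
  next_prob_sum1 : forall (q : Q) (x : seq V),
    (size x <= T)%N -> \sum_(v : V) next_prob q x v = 1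
}.

Section ARModel.
Variables (R : realType) (Q : Type) (V : finType) (T : nat).
Variable p : ar_model R Q V T.

(* p(y | q, x): the i-th token of y is preceded by x and by the first i
   tokens of y. *)
Definition cond_prob (q : Q) (x : seq V) (n : nat) (y : n.-tuple V) : R :=
  \prod_(i < n) next_prob p q (x ++ take i y) (tnth y i).

(* p(q, x_0, ..., x_{n-1}) *)
Definition joint_prob (q : Q) (n : nat) (x : n.-tuple V) : R :=
  prompt_prob p q * \prod_(s < n) next_prob p q (take s x) (tnth x s).

(* Since x = x_{0:t-1} has t tokens, for t <= T the continuations
   x_{t+1:T} and x_{t:T} have T - t and T - t + 1 tokens. *)
Definition pow_prob (alpha : R) (q : Q) (t : nat) (x : t.-tuple V) (v : V) : R :=
  (\sum_(y : (T - t).-tuple V) joint_prob q [tuple of x ++ v :: y] `^ alpha)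
  / (\sum_(y : (T - t).+1.-tuple V) joint_prob q [tuple of x ++ y] `^ alpha).

Definition zeta (alpha : R) (q : Q) (t : nat) (x : t.-tuple V) (v : V) : R :=
  \sum_(y : (T - t).-tuple V) cond_prob q (rcons x v) y `^ alpha.

End ARModel.

(* Main.v *)
Require Import Defs.
From HB Require Import structures.
From mathcomp Require Import all_boot all_order all_algebra.
From mathcomp Require Import reals exp.
Set Implicit Arguments.
Unset Strict Implicit.
Unset Printing Implicit Defensive.
Import Order.TTheory GRing.Theory Num.Theory.
Local Open Scope ring_scope.

(* By the chain rule p(q, x, v, y) = p(q, x) p(v | q, x) p(y | q, x, v), so
   p(q, x)^alpha factors out of both the numerator and the denominator of the
   power distribution, where it cancels because p(q, x) > 0. *)

(** Reindexing along the bijection between nonempty tuples and pairs (head, tail). It exposes the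
    token x_t in the denominator of [pow_prob]. *)
Lemma big_tuple_recl (S : Type) (idx : S) (op : Monoid.com_law idx)
    (V : finType) (n : nat) (F : n.+1.-tuple V -> S) :
  \big[op/idx]_(y : n.+1.-tuple V) F y =
  \big[op/idx]_(v : V) \big[op/idx]_(y : n.-tuple V) F [tuple of v :: y].
Proof.
rewrite pair_bigA /=.
rewrite (reindex (fun u : V * n.-tuple V => [tuple of u.1 :: u.2])) //=.
exists (fun y : n.+1.-tuple V => (thead y, [tuple of behead y])).
  by case=> v y _ /=; congr pair; apply: val_inj.
by move=> y _; rewrite [RHS]tuple_eta; apply: val_inj.
Qed.

Section ChainRule.
Variables (R : realType) (Q : Type) (V : finType) (T : nat).
Variables (p : ar_model R Q V T) (q : Q).

Lemma joint_probE (n : nat) (x : n.-tuple V) :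
  joint_prob p q x = prompt_prob p q * cond_prob p q [::] x.
Proof. by []. Qed.

(** The product splits at index [m]: beyond it, the tokens already read contain all of [y], which
    joins the context. *)
Lemma cond_prob_cat (x : seq V) (m n : nat) (y : m.-tuple V)
    (z : n.-tuple V) :
  cond_prob p q x [tuple of y ++ z] =
  cond_prob p q x y * cond_prob p q (x ++ y) z.
Proof.
rewrite /cond_prob big_split_ord /=; congr (_ * _); apply: eq_bigr => i _.
  by rewrite tnth_lshift takel_cat // size_tuple ltnW.
by rewrite tnth_rshift take_cat size_tuple ltnNge leq_addr /= addKn catA.
Qed.

Lemma cond_prob_cons (x : seq V) (n : nat) (v : V) (y : n.-tuple V) :
  cond_prob p q x [tuple of v :: y] =
  next_prob p q x v * cond_prob p q (rcons x v) y.
Proof.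
rewrite /cond_prob big_ord_recl /= cats0 tnth0; congr (_ * _).
by apply: eq_bigr => i _; rewrite tnthS -cat_rcons.
Qed.

Lemma joint_prob_cat_cons (m n : nat) (x : m.-tuple V) (v : V)
    (y : n.-tuple V) :
  joint_prob p q [tuple of x ++ v :: y] =
  joint_prob p q x * (next_prob p q x v * cond_prob p q (rcons x v) y).
Proof.
(* [cond_prob_cat] is used with the empty context, [[::] ++ x] being convertible to [x]. *)
by rewrite !joint_probE -cond_prob_cons -mulrA -(cond_prob_cat _ x).
Qed.

(** The longest prefix conditioned on has [size x + n - 1] tokens, hence the bound [T.+1]. *)
Lemma cond_prob_ge0 (x : seq V) (n : nat) (y : n.-tuple V) :
  (size x + n <= T.+1)%N -> 0 <= cond_prob p q x y.
Proof.
move=> le_xn_T; apply: prodr_ge0 => i _; apply: next_prob_ge0.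
have le_i_y : (i <= size y)%N by rewrite size_tuple ltnW.
rewrite size_cat (size_takel le_i_y) -ltnS.
by apply: leq_trans le_xn_T; rewrite ltn_add2l.
Qed.

Lemma sum_joint_prob_powR (alpha : R) (t : nat) (x : t.-tuple V) (v : V) :
  (t <= T)%N -> 0 < joint_prob p q x ->
  \sum_(y : (T - t).-tuple V) joint_prob p q [tuple of x ++ v :: y] `^ alpha =
  joint_prob p q x `^ alpha * (next_prob p q x v `^ alpha * zeta p alpha q x v).
Proof.
move=> le_tT x_gt0; rewrite /zeta !mulr_sumr; apply: eq_bigr => y _.
(* [powRM] distributes the power over a product of nonnegative factors, so signs come first. *)
have v_ge0 : 0 <= next_prob p q x v by apply: next_prob_ge0; rewrite size_tuple.
have y_ge0 : 0 <= cond_prob p q (rcons x v) y.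
  (* The lengths add up to (t + 1) + (T - t) = T + 1, exactly the bound allowed. *)
  by apply: cond_prob_ge0; rewrite size_rcons size_tuple addSn subnKC.
rewrite joint_prob_cat_cons (powRM _ (ltW x_gt0) (mulr_ge0 v_ge0 y_ge0)).
by rewrite (powRM _ v_ge0 y_ge0).
Qed.

End ChainRule.

Theorem theorem3p1 (R : realType) (Q : Type) (V : finType) (T : nat)
    (p : ar_model R Q V T) (q : Q) (hq : 0 < prompt_prob p q)
    (alpha : R) (halpha : 1 < alpha)
    (t : nat) (ht : (t <= T)%N)
    (x : t.-tuple V) (hx : 0 < joint_prob p q x) (v : V) :
  pow_prob p alpha q x v =
    (next_prob p q x v `^ alpha * zeta p alpha q x v)
    / (\sum_(v' : V) next_prob p q x v' `^ alpha * zeta p alpha q x v').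
Proof.
rewrite /pow_prob big_tuple_recl sum_joint_prob_powR //.
under [X in _ / X]eq_bigr => v' _ do rewrite sum_joint_prob_powR //.
(* Since the inverse of 0 is 0, [mulf_div] splits the quotient whatever the value of the remaining
   sum; only the common factor must be nonzero. *)
by rewrite -mulr_sumr -mulf_div divff ?mul1r // gt_eqF // powR_gt0.
Qed.
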